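(* Consider the radial Navier problem on the unit disc $$\begin{cases}u_t=\dfrac{u_ru_{rr}}{r}-\Delta_r^2u&r\in[0,1),\ t>0,\\ u(1,t)=\Delta_ru(1,t)=0&t>0,\\ u(r,0)=u_0(r)&r\in[0,1),\end{cases}$$ and let $u=u(r,t)$ be a smooth solution. If the quantity $$\int_0^1\left(\frac45r^5-\frac94r^4+\frac52r^2\right)(u_0)_r\,dr$$ is negative with sufficiently large absolute value (i.e. there is a constant $K>0$ such that it suffices that this integral be less than $-K$), then there exists $T^*<\infty$ such that $u$ ceases to exist (as a smooth solution) when $t\to T^*$.
   Context: $\Delta_r(\cdot)=\frac1r[r(\cdot)_r]_r$ is the radial Laplacian in $\mathbb{R}^2$ and $\Delta_r^2=\Delta_r\circ\Delta_r$. The problem is the radially symmetric form on $\Omega=B_1(0)\subset\mathbb{R}^2$ of $u_t=\det(D^2u)-\Delta^2u$ with $u=\Delta u=0$ on $\partial\Omega$. Smoothness of the solution (as a radial function on the disc) implies the symmetry condition $u_r(0,t)=0$ for all $t\ge0$ during the lapse of existence. ''Ceases to exist'' means that the smooth solution cannot be continued for all times: its lifespan as a smooth solution is a finite time $T^*$ (no assertion on unboundedness of a norm is made). *)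

(* Defs.v *)
From HB Require Import structures.
From mathcomp Require Import all_boot all_order all_algebra.
From mathcomp Require Import all_classical all_reals all_analysis.
Set Implicit Arguments.
Unset Strict Implicit.
Unset Printing Implicit Defensive.
Import Order.TTheory GRing.Theory Num.Theory.
Import numFieldNormedType.Exports.
Local Open Scope classical_set_scope.
Local Open Scope ring_scope.

(** * Smooth functions of several real variables *)

(** [F] is [C^n] on the open set [W], through iterated directional
    derivatives. *)
Fixpoint Cn_on (R : realType) (V : normedModType R) (n : nat) (W : set V)
    (F : V -> R) {struct n} : Prop :=
  (forall x, W x -> {for x, continuous F}) /\
  (if n is m.+1 then
     forall v : V, (forall x, W x -> derivable F x v) /\
                   Cn_on m W (fun x => 'D_v F x)
   else True).

(** Smoothness on a set [A] that need not be open: [F] coincides on [A], near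
    each point of [A], with a [C^oo] function on an open neighbourhood. *)
Definition smooth_on (R : realType) (V : normedModType R) (A : set V)
    (F : V -> R) : Prop :=
  forall p, A p -> exists W : set V, exists G : V -> R,
    [/\ open W, W p, (forall n, Cn_on n W G) &
        (forall q, A q -> W q -> F q = G q)].

(** * Radial calculus on the unit interval *)

(** Functions of [r] are only meaningful on [[0, 1]]: the derivative is taken
    relatively to [[0, 1]], hence it is one-sided at the two endpoints and the
    usual one inside. *)
Definition diff_quot (R : realType) (f : R -> R) (r s : R) : R :=
  (f s - f r) / (s - r).

Definition rderivable (R : realType) (f : R -> R) (r : R) : Prop :=
  cvg (diff_quot f r s @[s --> within `[0, 1] r^']).

Definition rderiv (R : realType) (f : R -> R) (r : R) : R :=
  lim (diff_quot f r s @[s --> within `[0, 1] r^']).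

Definition C1_01 (R : realType) (f : R -> R) : Prop :=
  (forall r, r \in `[0, 1] -> rderivable f r) /\
  {within `[0, 1], continuous (rderiv f)}.

(** Expressions involving [1 / r] are given at [r = 0] their limit as
    [r -> 0+]. *)
Definition ext0 (R : realType) (g : R -> R) (r : R) : R :=
  if r == 0 then lim (g s @[s --> (0 : R)^'+]) else g r.

Definition rlap (R : realType) (f : R -> R) : R -> R :=
  ext0 (fun r => r^-1 * rderiv (fun s => s * rderiv f s) r).

(** The determinant of the Hessian of the radial function with profile [f]. *)
Definition rhess_det (R : realType) (f : R -> R) : R -> R :=
  ext0 (fun r => rderiv f r * rderiv (rderiv f) r / r).

(** * The radial Navier problem *)

(** The function [(x, y, t) |-> u(|(x, y)|, t)]. *)
Definition disc_fun (R : realType) (u : R -> R -> R) (p : R * R * R) : R :=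
  u (Num.sqrt (p.1.1 ^+ 2 + p.1.2 ^+ 2)) p.2.

(** Closed unit disc times the open time interval [(0, T)]. *)
Definition disc_cyl (R : realType) (T : \bar R) : set (R * R * R) :=
  [set p | [/\ p.1.1 ^+ 2 + p.1.2 ^+ 2 <= 1, 0 < p.2 & (p.2%:E < T)%E]].

Definition rad_cyl (R : realType) (T : \bar R) : set (R * R) :=
  [set p | [/\ 0 <= p.1 <= 1, 0 <= p.2 & (p.2%:E < T)%E]].

(** [u r t] is a smooth solution on the time interval [[0, T)], with [T]
    possibly infinite: smooth for positive times, as a radial function on the
    closed disc, and continuous up to [t = 0].  The values of [u] outside
    [[0, 1] x [0, T)] are irrelevant. *)
Record smooth_solution (R : realType) (u0 : R -> R) (T : \bar R)
    (u : R -> R -> R) : Prop := SmoothSolution {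
  sol_time : (0 < T)%E ;
  sol_smooth : smooth_on (disc_cyl T) (disc_fun u) ;
  sol_cont : {within rad_cyl T, continuous (fun p : R * R => u p.1 p.2)} ;
  sol_eq : forall r t : R, 0 <= r < 1 -> 0 < t -> (t%:E < T)%E ->
    derive1 (u r) t = rhess_det (u ^~ t) r - rlap (rlap (u ^~ t)) r ;
  sol_bc0 : forall t : R, 0 < t -> (t%:E < T)%E -> u 1 t = 0 ;
  sol_bc2 : forall t : R, 0 < t -> (t%:E < T)%E -> rlap (u ^~ t) 1 = 0 ;
  sol_init : forall r : R, 0 <= r < 1 -> u r 0 = u0 r
}.

(** [v], on [[0, T')], continues the smooth solution [u], on [[0, T)]. *)
Definition continuation (R : realType) (u0 : R -> R) (T : \bar R)
    (u : R -> R -> R) (T' : \bar R) (v : R -> R -> R) : Prop :=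
  [/\ (T <= T')%E, smooth_solution u0 T' v &
      forall p, rad_cyl T p -> v p.1 p.2 = u p.1 p.2].

(** Supremum of the times up to which [u] can be continued as a smooth
    solution. *)
Definition lifespan (R : realType) (u0 : R -> R) (T : \bar R)
    (u : R -> R -> R) : \bar R :=
  ereal_sup [set T' | exists v, continuation u0 T u T' v].

(* Main.v *)
Require Import Defs.
From mathcomp Require Import all_boot all_order all_algebra.
From mathcomp Require Import all_classical all_reals all_analysis.
From mathcomp Require Import ring lra.
Import Order.TTheory GRing.Theory Num.Theory.
Import numFieldNormedType.Exports.
Local Open Scope classical_set_scope.
Local Open Scope ring_scope.

(** The proof tests the equation against a polynomial.  Write [w] for the
weight of the statement; then [w' = r * phi] with
[phi r = 4 r^3 - 9 r^2 + 5].  Since [u] vanishes at [r = 1] and [w] at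
[r = 0], the moment [y(t) = \int_0^1 r phi(r) u(r, t) dr] equals
[- \int_0^1 w u_r dr], so the hypothesis says that [y(0)] is large.

The polynomial [phi] vanishes at [r = 1], and so does its radial Laplacian
[36 (r - 1)].  Together with the Navier conditions, with [u_r(0, t) = 0], and
with the divergence form [u_r u_rr = (u_r^2 / 2)_r] of [r] times the
determinant, this makes every boundary term of the integrations by parts
disappear:
  [y' = \int_0^1 (3 r (3 - 2 r) u_r^2 + 36 r u_r) dr].
On [[0, 1]] one has [0 <= w <= 2 r], so completing squares gives, for every
real [l], the bound [y' >= l y - (l^2 + 26^2) / 2] ([moment_growth], which
rests on [moment_dissipation] and [coercivity]).  Optimizing over [l] it reads
[y' >= (y^2 - 26^2) / 2]; a Riccati argument ([riccati_time_bound]) bounds the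
length of any interval of existence by [2 / (y(0) - 26)] as soon as
[y(0) > 26].  The bound depends on [u0] only.  Applied to every continuation of
the given solution, it bounds the lifespan.

The regularity needed comes from restricting the solution to a radius.  In
[smooth_profile] a function of [(r, t)] is locally the restriction of a smooth
function on a neighbourhood in space-time.  This class is stable under the
relative derivative in [r] and under the derivative in [t], which yields the
four derivatives in [r], up to the endpoints, and the joint continuity of [u_t]
that allows differentiation of [y] under the integral sign.  At [r = 0] the
profile is even, whence [u_r(0, t) = 0].  At [t = 0] the solution is only
continuous, which suffices for the continuity of [y] and for identifying
[y(0)] through the fundamental theorem of calculus for [w u0]. *)

Set Implicit Arguments.
Unset Strict Implicit.
Unset Printing Implicit Defensive.

(** * Derivatives relative to the unit interval *)

Lemma within01_dnbhs_proper (R : realType) (r : R) :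
  0 <= r <= 1 -> ProperFilter (within `[0, 1] r^').
Proof.
move=> /andP[r0 r1]; apply: Build_ProperFilter => //.
rewrite /within/= => -[e /= e0 He].
have [d [d0 de d2]] : exists d : R, [/\ 0 < d, d < e & d <= 1 / 2].
  exists (Num.min (e / 2) (1 / 2)); split.
  - by rewrite lt_min; apply/andP; split; lra.
  - by rewrite gt_min; apply/orP; left; lra.
  - by rewrite ge_min lexx orbT.
have [r2|r2] := leP r (1 / 2).
- apply: (He (r + d)) => /=.
  + by rewrite opprD addNKr normrN gtr0_norm.
  + by apply/eqP; lra.
  + by rewrite in_itv/=; lra.
- apply: (He (r - d)) => /=.
  + by rewrite opprB addrC subrK gtr0_norm.
  + by apply/eqP; lra.
  + by rewrite in_itv/=; lra.
Qed.

Lemma near_within01 (R : realType) (r : R) (P : set R) :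
  (\forall s \near r, s != r -> 0 <= s <= 1 -> P s) ->
  \forall s \near within `[0, 1] r^', P s.
Proof.
by rewrite /within/=; apply: filterS => s H sr s01; apply: H => //;
  rewrite /= in_itv in s01.
Qed.

Lemma cvg_rderiv (R : realType) (f : R -> R) (r d : R) : 0 <= r <= 1 ->
  diff_quot f r s @[s --> within `[0, 1] r^'] --> d -> rderiv f r = d.
Proof.
by move=> r01; have FF := within01_dnbhs_proper r01; exact: cvg_lim.
Qed.

Lemma rderivable_cvg (R : realType) (f : R -> R) (r : R) :
  rderivable f r ->
  diff_quot f r s @[s --> within `[0, 1] r^'] --> rderiv f r.
Proof. by []. Qed.

(** Relative derivatives only see the values on [[0, 1]]: at an endpoint they
    can be computed on any function that extends [f] to a neighbourhood. *)
Lemma is_derive_cvg_diff_quot (R : realType) (f g : R -> R) (r d : R) :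
  0 <= r <= 1 -> is_derive r 1 g d ->
  (\forall s \near r, 0 <= s <= 1 -> f s = g s) ->
  diff_quot f r s @[s --> within `[0, 1] r^'] --> d.
Proof.
move=> r01 [dg gd] fg.
have : h^-1 *: ((g \o shift r) (h *: 1) - g r) @[h --> 0^'] --> d.
  by rewrite -gd; exact: dg.
move=> /cvgrPdist_lt H; apply/cvgrPdist_lt => e e0.
case: (H _ e0) => a /= a0 Ha; case: fg => b /= b0 Hb.
have fgr : f r = g r by apply: Hb => //=; rewrite subrr normr0.
apply: near_within01; near=> s => sr s01.
have sb : `|r - s| < b by near: s; exists b.
have sa : `|r - s| < a by near: s; exists a.
rewrite /diff_quot fgr Hb//.
have := Ha (s - r); rewrite /= sub0r normrN distrC subr_eq0.
move=> /(_ sa sr); rewrite /GRing.scale/= mulr1 subrK.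
by rewrite mulrC.
Unshelve. all: by end_near. Qed.

Lemma rderivable_is_derive (R : realType) (f : R -> R) (r : R) :
  0 < r < 1 -> rderivable f r -> is_derive r 1 f (rderiv f r).
Proof.
move=> r01 /rderivable_cvg fr.
have : h^-1 *: ((f \o shift r) (h *: 1) - f r) @[h --> 0^'] --> rderiv f r.
  apply/cvgrPdist_lt => e e0; move/cvgrPdist_lt : fr => /(_ _ e0).
  rewrite /within/= => -[a /= a0 Ha].
  near=> h.
  have h0 : h != 0 by near: h; exact: nbhs_dnbhs_neq.
  have ha : `|h| < a.
    by near: h; apply: nbhs_dnbhs; exists a => // x /=; rewrite sub0r normrN.
  have h1 : `|h| < Num.min r (1 - r).
    near: h; apply: nbhs_dnbhs; exists (Num.min r (1 - r)) => /=.
      by rewrite lt_min; apply/andP; split; lra.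
    by move=> x /=; rewrite sub0r normrN.
  have := Ha (h + r); rewrite /= opprD addrCA subrr addr0 normrN => /(_ ha).
  have -> : h + r != r by apply: contra h0 => /eqP ?; apply/eqP; lra.
  move: h1; rewrite lt_min !ltr_norml in_itv/= => h1 /(_ isT).
  rewrite /diff_quot addrK [h *: 1]mulr1 [h^-1 *: _]mulrC; apply; lra.
move=> H; split; first by apply/cvg_ex; exists (rderiv f r).
exact: cvg_lim H.
Unshelve. all: by end_near. Qed.

Lemma rderivable_cvgr (R : realType) (f : R -> R) (r : R) :
  rderivable f r -> f s @[s --> within `[0, 1] r^'] --> f r.
Proof.
move=> /rderivable_cvg fr.
have : f r + diff_quot f r s * (s - r) @[s --> within `[0, 1] r^'] -->
    f r + rderiv f r * (r - r).
  apply: cvgD; first exact: cvg_cst.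
  apply: cvgM => //; apply: cvgB; last exact: cvg_cst.
  by move=> P rP; apply: near_within01; apply: filterS rP.
rewrite subrr mulr0 addr0; apply: cvg_trans; apply: near_eq_cvg.
apply: near_within01; near=> s => sr _.
have {}sr : s - r != 0 by rewrite subr_eq0.
by rewrite /diff_quot divfK// addrC subrK.
Unshelve. all: by end_near. Qed.

Lemma rderivable_continuous (R : realType) (f : R -> R) :
  (forall r, 0 <= r <= 1 -> rderivable f r) -> {within `[0, 1], continuous f}.
Proof.
move=> df; apply/subspace_continuousP => r; rewrite /= in_itv/= => r01.
apply/cvgrPdist_lt => e e0.
move/cvgrPdist_lt : (rderivable_cvgr (df r r01)) => /(_ _ e0).
move=> H; change (\forall s \near r, `[0, 1]%classic s -> `|f r - f s| < e).
have {}H : \forall s \near r, s != r -> `[0, 1]%classic s ->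
  `|f r - f s| < e by exact: H.
apply: filterS H => s H s01.
by have [->|sr] := eqVneq s r; [rewrite subrr normr0|exact: H].
Qed.

Lemma cvg_diff_quotM (R : realType) (f g : R -> R) (r : R) :
  rderivable f r -> rderivable g r ->
  diff_quot (fun s => f s * g s) r s @[s --> within `[0, 1] r^'] -->
  rderiv f r * g r + f r * rderiv g r.
Proof.
move=> df dg.
have : diff_quot f r s * g s + f r * diff_quot g r s @[s --> within `[0, 1] r^']
  --> rderiv f r * g r + f r * rderiv g r.
  apply: cvgD; apply: cvgM => //; first exact: rderivable_cvgr.
  exact: cvg_cst.
suff -> : diff_quot (fun s => f s * g s) r =
    fun s => diff_quot f r s * g s + f r * diff_quot g r s by [].
apply/funext => s; rewrite /diff_quot mulrAC mulrA -mulrDl.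
by congr (_ / _); ring.
Qed.

(** * Restriction of smooth functions on the cylinder to a radius *)

(** The positions are kept in the plane although only the radius along the
    first axis is concerned: the smooth extensions provided by a solution
    live on open sets of [R * R * R], so no restriction of iterated
    directional derivatives to a subspace is ever taken. *)
Definition axis_cyl (R : realType) (T : \bar R) : set (R * R * R) :=
  [set p | [/\ 0 <= p.1.1 <= 1, p.1.2 = 0, 0 < p.2 & (p.2%:E < T)%E]].

Definition smooth_profile (R : realType) (T : \bar R) (U : R -> R -> R) :=
  smooth_on (axis_cyl T) (fun p : R * R * R => U p.1.1 p.2).

Lemma Cn_on_derive (R : realType) (V : normedModType R) (W : set V) (F : V -> R)
    (v : V) :
  (forall n, Cn_on n W F) -> forall n, Cn_on n W (fun x => 'D_v F x).
Proof. by move=> H n; case: (H n.+1) => _ /(_ v)[]. Qed.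

Lemma is_derive_line (R : realType) (V : normedModType R) (F : V -> R)
    (l : R -> V) (v : V) (a : R) :
  (forall h, l (h + a) = h *: v + l a) -> derivable F (l a) v ->
  is_derive a 1 (fun x => F (l x)) ('D_v F (l a)).
Proof.
move=> lv dF.
have E : (fun h => h^-1 *: (((fun x => F (l x)) \o shift a) (h *: 1) - F (l a)))
       = (fun h => h^-1 *: ((F \o shift (l a)) (h *: v) - F (l a))).
  by apply/funext => h /=; rewrite [h *: 1]mulr1 lv.
split; first by rewrite /derivable E.
by rewrite {1}/derive E.
Qed.

Lemma near_lt_ereal (R : realType) (T : \bar R) (t : R) :
  (t%:E < T)%E -> \forall s \near t, (s%:E < T)%E.
Proof.
case: T => [T| |//]; last by move=> _; near=> s; rewrite ltry.
by rewrite lte_fin => tT; near=> s; rewrite lte_fin; near: s; exact: lt_nbhsl.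
Unshelve. all: by end_near. Qed.

Section AxisSlices.
Context (R : realType).

Definition dir_r : R * R * R := ((1, 0), 0).
Definition dir_t : R * R * R := ((0, 0), 1).

Lemma near_axis_r (W : set (R * R * R)) (r t : R) : open W -> W ((r, 0), t) ->
  \forall x \near r, W ((x, 0), t).
Proof.
move=> oW Wrt; have : ((x, 0 : R), t) @[x --> r] --> ((r, 0 : R), t).
  exact: (cvg_pair (cvg_pair cvg_id (cvg_cst _)) (cvg_cst _)).
by apply; exact: open_nbhs_nbhs.
Qed.

Lemma near_axis_t (W : set (R * R * R)) (r t : R) : open W -> W ((r, 0), t) ->
  \forall s \near t, W ((r, 0), s).
Proof.
move=> oW Wrt; have : ((r, 0 : R), s) @[s --> t] --> ((r, 0 : R), t).
  exact: (cvg_pair (cvg_cst _) cvg_id).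
by apply; exact: open_nbhs_nbhs.
Qed.

Lemma is_derive_axis_r (W : set (R * R * R)) (G : R * R * R -> R) (r t : R) :
  Cn_on 1 W G -> W ((r, 0), t) ->
  is_derive r 1 (fun x => G ((x, 0), t)) ('D_(dir_r) G ((r, 0), t)).
Proof.
move=> cG Wrt; apply: (@is_derive_line _ _ G (fun x => ((x, 0), t)) dir_r).
  move=> h; rewrite /dir_r; congr ((_, _), _) => /=.
  - by rewrite [h%:A]mulr1.
  - by rewrite addr0 [h *: _]mulr0.
  - by rewrite [h *: _]mulr0 add0r.
by have [_ /(_ dir_r)[+ _]] := cG; exact.
Qed.

Lemma is_derive_axis_t (W : set (R * R * R)) (G : R * R * R -> R) (r t : R) :
  Cn_on 1 W G -> W ((r, 0), t) ->
  is_derive t 1 (fun s => G ((r, 0), s)) ('D_(dir_t) G ((r, 0), t)).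
Proof.
move=> cG Wrt; apply: (@is_derive_line _ _ G (fun s => ((r, 0), s)) dir_t).
  move=> h; rewrite /dir_t; congr ((_, _), _) => /=.
  - by rewrite [h *: _]mulr0 add0r.
  - by rewrite addr0 [h *: _]mulr0.
  - by rewrite [h%:A]mulr1.
by have [_ /(_ dir_t)[+ _]] := cG; exact.
Qed.

End AxisSlices.

Section Profile.
Context (R : realType) (T : \bar R) (U : R -> R -> R).
Hypothesis sU : smooth_profile T U.

Let dr_cvg W G : open W -> (forall n, Cn_on n W G) ->
  (forall q, axis_cyl T q -> W q -> U q.1.1 q.2 = G q) ->
  forall r t, axis_cyl T ((r, 0), t) -> W ((r, 0), t) ->
  diff_quot (U ^~ t) r s @[s --> within `[0, 1] r^'] -->
    'D_(dir_r R) G ((r, 0), t).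
Proof.
move=> oW cG UG r t [/= r01 _ t0 tT] Wrt.
apply: (is_derive_cvg_diff_quot r01 (is_derive_axis_r (cG 1%N) Wrt)).
apply: filterS (near_axis_r oW Wrt) => x Wx x01.
by rewrite -(UG ((x, 0), t)).
Qed.

Let dt_is_derive W G : open W -> (forall n, Cn_on n W G) ->
  (forall q, axis_cyl T q -> W q -> U q.1.1 q.2 = G q) ->
  forall r t, axis_cyl T ((r, 0), t) -> W ((r, 0), t) ->
  is_derive t 1 (U r) ('D_(dir_t R) G ((r, 0), t)).
Proof.
move=> oW cG UG r t [/= r01 _ t0 tT] Wrt.
apply: near_eq_is_derive (is_derive_axis_t (cG 1%N) Wrt).
near=> s; rewrite -(UG ((r, 0), s))//=.
  split => //=; near: s; [exact: (lt_nbhsr t0)|exact: (near_lt_ereal tT)].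
by near: s; exact: near_axis_t.
Unshelve. all: by end_near. Qed.

(** Near each point the relative derivative in [r] of the profile is the
    directional derivative of its smooth extension, hence a profile again:
    iterating this gives all derivatives in [r]. *)
Lemma profile_dr : smooth_profile T (fun r t => rderiv (U ^~ t) r).
Proof.
move=> p Ap; have [W [G [oW Wp cG UG]]] := sU Ap.
exists W, ('D_(dir_r R) G); split => //; first exact: Cn_on_derive.
move=> [[r y] t] A W'; have [/= r01 y0 _ _] := A; rewrite y0 in A W' *.
by apply: cvg_rderiv => //; exact: (dr_cvg oW cG UG).
Qed.

Lemma profile_dt : smooth_profile T (fun r t => derive1 (U r) t).
Proof.
move=> p Ap; have [W [G [oW Wp cG UG]]] := sU Ap.
exists W, ('D_(dir_t R) G); split => //; first exact: Cn_on_derive.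
move=> [[r y] t] A W'; have [/= r01 y0 _ _] := A; rewrite y0 in A W' *.
rewrite derive1E.
exact: (@derive_val _ _ _ _ _ _ _ (dt_is_derive oW cG UG A W')).
Qed.

Lemma profile_rderivable (r t : R) : 0 <= r <= 1 -> 0 < t -> (t%:E < T)%E ->
  rderivable (U ^~ t) r.
Proof.
move=> r01 t0 tT; have A : axis_cyl T ((r, 0), t) by split.
have [W [G [oW Wp cG UG]]] := sU A.
apply/cvg_ex; exists ('D_(dir_r R) G ((r, 0), t)).
exact: (dr_cvg oW cG UG A Wp).
Qed.

Lemma profile_is_derive (r t : R) : 0 <= r <= 1 -> 0 < t -> (t%:E < T)%E ->
  is_derive t 1 (U r) (derive1 (U r) t).
Proof.
move=> r01 t0 tT; have A : axis_cyl T ((r, 0), t) by split.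
have [W [G [oW Wp cG UG]]] := sU A.
have H := dt_is_derive oW cG UG A Wp.
by rewrite derive1E (@derive_val _ _ _ _ _ _ _ H).
Qed.

Lemma profile_continuous :
  {within [set p : R * R | [/\ 0 <= p.1 <= 1, 0 < p.2 & (p.2%:E < T)%E]],
    continuous (fun p : R * R => U p.1 p.2)}.
Proof.
apply/subspace_continuousP => -[r t] [/= r01 t0 tT].
have A : axis_cyl T ((r, 0), t) by split.
have [W [G [oW Wp cG UG]]] := sU A.
have cGr : {for ((r, 0), t), continuous G} by case: (cG 0%N) => + _; apply.
have lc : ((p.1, 0 : R), p.2) @[p --> (r, t)] --> ((r, 0 : R), t).
  exact: (cvg_pair (cvg_pair cvg_fst (cvg_cst _)) cvg_snd).
have UGr : U r t = G ((r, 0), t) := UG ((r, 0), t) A Wp.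
move=> P; change (nbhs (U r t) P -> \forall p \near (r, t),
  [/\ 0 <= p.1 <= 1, 0 < p.2 & (p.2%:E < T)%E] -> P (U p.1 p.2)).
rewrite UGr => /cGr GP.
have {}GP : \forall p \near (r, t), P (G ((p.1, 0), p.2)) := lc _ GP.
have WP : \forall p \near (r, t), W ((p.1, 0), p.2).
  exact: (lc _ (open_nbhs_nbhs (conj oW Wp))).
near=> p => -[x01 s0 sT].
rewrite (UG ((p.1, 0), p.2) _ _ : U p.1 p.2 = _) //; last by near: p.
by near: p.
Unshelve. all: by end_near. Qed.

End Profile.

(** * Regularity of a solution along a radius *)

Section SolutionProfile.
Context (R : realType) (u0 : R -> R) (T : \bar R) (u : R -> R -> R).
Hypothesis su : smooth_solution u0 T u.

Lemma solution_profile : smooth_profile T u.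
Proof.
have A q : axis_cyl T q -> disc_cyl T q /\ disc_fun u q = u q.1.1 q.2.
  move=> [/andP[q0 q1] y0 t0 tT].
  rewrite /disc_cyl /disc_fun /= y0 expr0n/= addr0.
  rewrite sqrtr_sqr ger0_norm//; split => //; split => //.
  by rewrite expr_le1.
move=> p /A[Dp _]; have [W [G [oW Wp cG uG]]] := sol_smooth su Dp.
by exists W, G; split => // q /A[Dq <-]; exact: uG.
Qed.

(** Read on the whole line through the origin, the profile of a function of
    [|x|] is even, so its derivative at [0] is its own opposite. *)
Lemma solution_rderiv0 (t : R) : 0 < t -> (t%:E < T)%E ->
  rderiv (u ^~ t) 0 = 0.
Proof.
move=> t0 tT; have D x : `|x| <= 1 -> disc_cyl T ((x, 0), t).
  move=> x1; split => //=; rewrite expr0n/= addr0.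
  by rewrite -(real_normK (num_real x)) expr_le1.
have D0 : disc_cyl T ((0, 0), t) by apply: D; rewrite normr0.
have [W [G [oW Wp cG uG]]] := sol_smooth su D0.
pose g x := G ((x, 0), t).
have gu : \forall x \near (0 : R), g x = u `|x| t.
  near=> x; rewrite /g -uG.
  - by rewrite /disc_fun/= expr0n/= addr0 sqrtr_sqr.
  - apply: D; near: x.
    by exists 1 => //= x; rewrite /ball_ /= sub0r normrN => /ltW.
  - by near: x; exact: (near_axis_r oW Wp).
have dg : is_derive (0 : R) 1 g ('D_(dir_r R) G ((0, 0), t)) :=
  is_derive_axis_r (cG 1%N) Wp.
set d := 'D_(dir_r R) G _ in dg.
have dgN : is_derive (0 : R) 1 g (- d).
  have dN : is_derive (0 : R) 1 -%R (- 1) by exact: is_deriveNid.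
  have := @is_derive1_comp _ g -%R 0 d (-1).
  rewrite oppr0 => /(_ dg dN); rewrite [_ * _]mulrC mulN1r => H.
  apply: (near_eq_is_derive _ H).
  near=> x => /=; have -> : g x = u `|x| t by near: x.
  rewrite -normrN; near: x.
  have N0 : -%R x @[x --> (0 : R)] --> (0 : R).
    by rewrite -[X in _ --> X]oppr0; apply: cvgN.
  exact: (N0 _ gu).
have dd : d = - d.
  by rewrite -(@derive_val _ _ _ _ _ _ _ dgN) (@derive_val _ _ _ _ _ _ _ dg).
have d0 : d = 0 by lra.
apply: cvg_rderiv; first lra.
rewrite -[X in _ --> X]d0; apply: (is_derive_cvg_diff_quot _ dg); first lra.
near=> x => /andP[x0 x1]; rewrite /g.
have -> : G ((x, 0), t) = u `|x| t by near: x.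
by rewrite ger0_norm.
Unshelve. all: by end_near. Qed.

End SolutionProfile.

(** * The weight and functions continuous on the unit interval *)

Definition cont01 (R : realType) (f : R -> R) : Prop :=
  {within `[0, 1], continuous f}.

Section Cont01.
Context (R : realType).
Implicit Types f g : R -> R.

Lemma cont01_cst (c : R) : cont01 (fun _ => c).
Proof. by move=> x; exact: cvg_cst. Qed.

Lemma cont01_id : cont01 (fun x : R => x).
Proof. by apply: continuous_subspaceT => x; exact: cvg_id. Qed.

Lemma cont01D f g : cont01 f -> cont01 g -> cont01 (fun x => f x + g x).
Proof. by move=> cf cg x; apply: cvgD; [exact: cf|exact: cg]. Qed.

Lemma cont01N f : cont01 f -> cont01 (fun x => - f x).
Proof. by move=> cf x; apply: cvgN; exact: cf. Qed.

Lemma cont01M f g : cont01 f -> cont01 g -> cont01 (fun x => f x * g x).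
Proof. by move=> cf cg x; apply: cvgM; [exact: cf|exact: cg]. Qed.

Lemma cont01X f n : cont01 f -> cont01 (fun x => f x ^+ n).
Proof.
move=> cf; elim: n => [|n IHn].
  by under eq_fun do rewrite expr0; exact: cont01_cst.
by under eq_fun do rewrite exprS; exact: cont01M.
Qed.

Lemma is_derive_cont01 f (df : R -> R) :
  (forall x : R, is_derive x 1 f (df x)) -> cont01 f.
Proof.
move=> Df; apply: continuous_subspaceT => x.
apply/differentiable_continuous/derivable1_diffP.
by have ? := Df x; exact: ex_derive.
Qed.

End Cont01.

(* The head symbol of the body is matched syntactically: trying the lemmas one
   after the other would unfold the operations of the abstract field. *)
Ltac prove_cont01 := lazymatch goal with
  | |- cont01 (fun x => @?f x + @?g x) =>
      refine (@cont01D _ f g _ _); [prove_cont01|prove_cont01]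
  | |- cont01 (fun x => - @?f x) => refine (@cont01N _ f _); prove_cont01
  | |- cont01 (fun x => @?f x * @?g x) =>
      refine (@cont01M _ f g _ _); [prove_cont01|prove_cont01]
  | |- cont01 (fun x => @?f x ^+ ?n) => refine (@cont01X _ f n _); prove_cont01
  | |- cont01 (fun x => x) => exact (@cont01_id _)
  | |- cont01 (fun x => ?g x) =>
      match goal with H : cont01 ?h |- _ => constr_eq g h; exact H end
  | |- cont01 (fun _ => ?c) => exact (@cont01_cst _ c)
  | |- cont01 ?g => match goal with H : cont01 _ |- _ => exact H end
  end.

Lemma Rintegral_FTC01 (R : realType) (F f : R -> R) :
  cont01 f -> cont01 F ->
  (forall r : R, 0 < r < 1 -> is_derive r 1 F (f r)) ->
  \int[lebesgue_measure]_(r in `[0, 1]) f r = F 1 - F 0.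
Proof.
move=> cf cF dF; rewrite /Rintegral (@continuous_FTC2 _ _ F) ?ltr01//.
- have [cF' F0 F1] := (continuous_within_itvP F (@ltr01 R)).1 cF.
  split => // r; rewrite in_itv/= => /dF ?; exact: ex_derive.
- by move=> r; rewrite in_itv/= => /dF ?; rewrite derive1E derive_val.
Qed.

Lemma Rintegrable01 (R : realType) (f : R -> R) :
  cont01 f ->
  lebesgue_measure.-integrable `[0, 1] (EFin \o f).
Proof.
move=> cf; apply: continuous_compact_integrable => //.
exact: segment_compact.
Qed.

Section Moment.
Context (R : realType).
Implicit Types (r : R).

Definition weight r : R := 4 / 5 * r ^+ 5 - 9 / 4 * r ^+ 4 + 5 / 2 * r ^+ 2.
(** Quotient by [r] of the derivative of [weight], and the function against
    which the equation is tested: [phi] and its radial Laplacian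
    [36 * (r - 1)] both vanish at [r = 1]. *)
Definition phi r : R := 4 * r ^+ 3 - 9 * r ^+ 2 + 5.

Lemma is_derive_weight r : is_derive r 1 weight (r * phi r).
Proof.
rewrite /weight; apply: is_derive_eq; rewrite /phi /GRing.scale/=; lra.
Qed.

Lemma is_derive_phi r : is_derive r 1 phi (12 * r ^+ 2 - 18 * r).
Proof.
rewrite /phi; apply: is_derive_eq; rewrite /GRing.scale/=; ring.
Qed.

Lemma weight_cont01 : cont01 weight.
Proof. exact: is_derive_cont01 is_derive_weight. Qed.

Lemma phi_cont01 : cont01 phi.
Proof. exact: is_derive_cont01 is_derive_phi. Qed.

(** With [p] in the role of [u_r].  Write [weight r = r * g] with
    [0 <= g <= 2].  Of the quadratic term, at least [3 * r * p ^+ 2], one third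
    absorbs [36 * r * p] at the cost [324 * r]; the rest, at least
    [2 * (r * p) ^+ 2], absorbs [l * g * (r * p)] at the cost [l ^+ 2 / 2].
    The constant is rounded up to [338 = 26 ^+ 2 / 2]. *)
Lemma coercivity (r p l : R) : 0 <= r <= 1 ->
  - (l ^+ 2 / 2 + 338) <=
    (18 * r - 12 * r ^+ 2) * p ^+ 2 / 2 + 36 * r * p + l * weight r * p.
Proof.
move=> /andP[r0 r1].
pose g := 4 / 5 * r ^+ 4 - 9 / 4 * r ^+ 3 + 5 / 2 * r.
have gE : weight r = r * g by rewrite /weight /g; ring.
have r2 : 0 <= r ^+ 2 <= r by rewrite sqr_ge0 expr2 ler_piMl.
have r3 : 0 <= r ^+ 3 <= r ^+ 2.
  by rewrite exprn_ge0// [_ ^+ 3]exprS ler_piMl ?sqr_ge0.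
have r4 : 0 <= r ^+ 4 <= r ^+ 3.
  by rewrite exprn_ge0// [_ ^+ 4]exprS ler_piMl ?exprn_ge0.
have g2 : g ^+ 2 <= 4.
  (* [r ^+ 3] lies above its tangent at [1 / 2]; this keeps [g] below [2]. *)
  have : 0 <= (r - 1 / 2) ^+ 2 * (r + 1) by rewrite mulr_ge0 ?sqr_ge0 ?addr_ge0.
  move=> tangent.
  have : -2 <= g <= 2 by rewrite /g; lra.
  by nra.
rewrite gE.
have H1 : 0 <= r * (p + 18) ^+ 2 by rewrite mulr_ge0 ?sqr_ge0.
have H2 : 0 <= 2 * (r * p + g * l / 4) ^+ 2 + l ^+ 2 * (4 - g ^+ 2) / 8.
  apply: addr_ge0; first by rewrite mulr_ge0 ?sqr_ge0.
  by rewrite divr_ge0// mulr_ge0 ?sqr_ge0// subr_ge0.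
have H3 : 0 <= (r - r ^+ 2) * p ^+ 2 by apply: mulr_ge0; [lra|exact: sqr_ge0].
have H4 : 0 <= (1 - r) * p ^+ 2 * r.
  by rewrite mulr_ge0// mulr_ge0 ?sqr_ge0// subr_ge0.
nra.
Qed.

End Moment.

(** * Radial Laplacian and bilaplacian *)

Section RadialLaplacian.
Context (R : realType) (f : R -> R).
Let f1 := rderiv f.
Let f2 := rderiv f1.
Let f3 := rderiv f2.
Let f4 := rderiv f3.
Hypotheses (df1 : forall r, 0 <= r <= 1 -> rderivable f1 r)
  (df2 : forall r, 0 <= r <= 1 -> rderivable f2 r)
  (df3 : forall r, 0 <= r <= 1 -> rderivable f3 r).

Lemma rlapE (r : R) : 0 < r <= 1 -> rlap f r = f2 r + f1 r / r.
Proof.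
move=> /andP[r0 r1]; have r01 : 0 <= r <= 1 by lra.
rewrite /rlap /ext0 gt_eqF//.
have did : diff_quot id r s @[s --> within `[0, 1] r^'] --> (1 : R).
  apply: (is_derive_cvg_diff_quot r01 (is_derive_id r (1 : R))).
  exact: (@nearW _ (nbhs r)).
have did' : rderivable id r by apply/cvg_ex; exists 1.
rewrite (cvg_rderiv r01 (cvg_diff_quotM did' (df1 r01))) (cvg_rderiv r01 did).
by rewrite -/f2 /=; field; rewrite gt_eqF.
Qed.

Let near01 (r : R) : 0 < r < 1 -> \forall s \near r, 0 < s < 1.
Proof.
move=> /andP[r0 r1]; near=> s; apply/andP; split; near: s.
  exact: lt_nbhsr r0.
exact: lt_nbhsl r1.
Unshelve. all: by end_near. Qed.

Let is_derive_loc (g h : R -> R) (r d : R) : 0 < r < 1 ->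
  (forall s, 0 < s < 1 -> h s = g s) -> is_derive r 1 h d -> is_derive r 1 g d.
Proof.
move=> r01 gh; apply: near_eq_is_derive.
by apply: filterS (near01 r01) => s /gh.
Qed.

Let is_derive_rderiv (g : R -> R) (r d : R) : 0 < r < 1 ->
  is_derive r 1 g d -> rderiv g r = d.
Proof.
move=> /andP[r0 r1] dg; have r01 : 0 <= r <= 1 by lra.
apply: (cvg_rderiv r01); apply: (is_derive_cvg_diff_quot r01 dg).
exact: (@nearW _ (nbhs r)).
Qed.

Let D (g : R -> R) (dg : forall r, 0 <= r <= 1 -> rderivable g r) (r : R)
  (r01 : 0 < r < 1) : is_derive r 1 g (rderiv g r).
Proof. by apply: rderivable_is_derive => //; apply: dg; lra. Qed.

Lemma is_derive_rlap (r : R) : 0 < r < 1 ->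
  is_derive r 1 (rlap f) (f3 r + f2 r / r - f1 r / r ^+ 2).
Proof.
move=> r01; have r0 : r != 0 by rewrite gt_eqF//; lra.
apply: (@is_derive_loc _ (fun s => f2 s + f1 s / s)) => //.
  by move=> s s01; rewrite rlapE//; lra.
have := D df2 r01; have := D df1 r01; rewrite -/f2 -/f3 => D1 D2.
have DV := is_deriveV (f := id) r0 (is_derive_id r (1 : R)).
apply: is_derive_eq; rewrite /GRing.scale/=; field; exact: r0.
Qed.

Lemma bilaplacianE (r : R) : 0 < r < 1 -> rlap (rlap f) r =
  f4 r + 2 * f3 r / r - f2 r / r ^+ 2 + f1 r / r ^+ 3.
Proof.
move=> r01; have r0 : r != 0 by rewrite gt_eqF//; lra.
rewrite {1}/rlap /ext0 (negbTE r0).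
have -> : rderiv (fun s => s * rderiv (rlap f) s) r =
    r * f4 r + 2 * f3 r - f2 r / r + f1 r / r ^+ 2.
  apply: is_derive_rderiv => //.
  apply: (@is_derive_loc _
    (fun s => s * (f3 s + f2 s / s - f1 s * s^-1 ^+ 2))) => //.
    by move=> s s01; rewrite exprVn (is_derive_rderiv s01 (is_derive_rlap s01)).
  have := D df3 r01; have := D df2 r01; have := D df1 r01.
  rewrite -/f2 -/f3 -/f4 => D1 D2 D3.
  have DV := is_deriveV (f := id) r0 (is_derive_id r (1 : R)).
  apply: is_derive_eq; rewrite /GRing.scale/=; field; exact: r0.
by field.
Qed.

End RadialLaplacian.

(** * Dissipation inequality at a fixed time *)

Lemma near_neq0 (R : realType) (r : R) : r != 0 -> \forall s \near r, s != 0.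
Proof.
move=> r0; exists `|r|; rewrite /= ?normr_gt0// => s /=.
by apply: contraTneq => ->; rewrite subr0 ltxx.
Qed.

(** The integrations by parts of the determinant, of the bilaplacian and of
    the weight, gathered in a single derivative.  The bilaplacian leaves
    [- 36 * r * g1 r] only, because [(r * phi' r)' = 36 * r * (r - 1)] and
    [36 * (r - 1)] has derivative [36]. *)
Lemma is_derive_flux_formula (R : realType) (g g1 g2 g3 : R -> R) (d4 l r : R) :
  r != 0 -> is_derive r 1 g (g1 r) -> is_derive r 1 g1 (g2 r) ->
  is_derive r 1 g2 (g3 r) -> is_derive r 1 g3 d4 ->
  is_derive r 1 (fun r =>
    phi r * g1 r ^+ 2 / 2 - phi r * (r * g3 r + g2 r - g1 r / r)
    + (12 * r ^+ 2 - 18 * r) * (r * g2 r + g1 r) - 36 * (r - 1) * (r * g1 r)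
    - l * (weight r * g r))
  (r * phi r * (g1 r * g2 r / r -
     (d4 + 2 * g3 r / r - g2 r / r ^+ 2 + g1 r / r ^+ 3) - l * g r)
   + (12 * r ^+ 2 - 18 * r) * g1 r ^+ 2 / 2
   - 36 * r * g1 r - l * weight r * g1 r).
Proof.
move=> r0 D1 D2 D3 D4.
have DV := is_deriveV (f := id) r0 (is_derive_id r (1 : R)).
have Dw := is_derive_weight r; have Dp := is_derive_phi r.
have A1 : is_derive r 1 (fun r => phi r * g1 r ^+ 2 / 2)
  ((12 * r ^+ 2 - 18 * r) * g1 r ^+ 2 / 2 + phi r * g1 r * g2 r).
  apply: is_derive_eq; rewrite /GRing.scale/=; lra.
have A2 : is_derive r 1 (fun r => phi r * (r * g3 r + g2 r - g1 r / r))
  ((12 * r ^+ 2 - 18 * r) * (r * g3 r + g2 r - g1 r / r) +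
   phi r * (r * d4 + 2 * g3 r - g2 r / r + g1 r / r ^+ 2)).
  apply: is_derive_eq; rewrite /GRing.scale/=; by field.
have A3 : is_derive r 1 (fun r => (12 * r ^+ 2 - 18 * r) * (r * g2 r + g1 r))
  ((24 * r - 18) * (r * g2 r + g1 r) +
   (12 * r ^+ 2 - 18 * r) * (r * g3 r + 2 * g2 r)).
  apply: is_derive_eq; rewrite /GRing.scale/=; ring.
have A4 : is_derive r 1 (fun r => 36 * (r - 1) * (r * g1 r))
  (36 * r * g1 r + 36 * (r - 1) * (r * g2 r + g1 r)).
  apply: is_derive_eq; rewrite /GRing.scale/=; ring.
have A5 : is_derive r 1 (fun r => l * (weight r * g r))
  (l * (r * phi r * g r + weight r * g1 r)).
  apply: is_derive_eq; rewrite /GRing.scale/=; ring.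
have := is_deriveB (is_deriveB (is_deriveD (is_deriveB A1 A2) A3) A4) A5.
move/is_derive_eq; apply; by field.
Qed.

Section Dissipation.
Context (R : realType) (f q : R -> R).
Let f1 := rderiv f.
Let f2 := rderiv f1.
Let f3 := rderiv f2.
Let f4 := rderiv f3.
Hypotheses (df : forall r, 0 <= r <= 1 -> rderivable f r)
  (df1 : forall r, 0 <= r <= 1 -> rderivable f1 r)
  (df2 : forall r, 0 <= r <= 1 -> rderivable f2 r)
  (df3 : forall r, 0 <= r <= 1 -> rderivable f3 r).
Hypotheses (f10 : f1 0 = 0) (fb : f 1 = 0) (lapb : rlap f 1 = 0).
Hypotheses (cq : cont01 q)
  (qE : forall r, 0 < r < 1 -> q r = rhess_det f r - rlap (rlap f) r).

(* [f1 r / r] extended by its limit at [0], so that the flux below is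
   continuous on the closed interval. *)
Let slope (r : R) : R := if r == 0 then f2 0 else f1 r / r.

Let slope_continuous : cont01 slope.
Proof.
apply/subspace_continuousP => r; rewrite /= in_itv/= => r01.
have [r0|r0] := eqVneq r 0; last first.
  have : f1 s / s @[s --> within `[0, 1] (nbhs r)] --> f1 r / r.
    apply: cvgM; last by apply: cvgV => //; exact: cvg_within.
    have /subspace_continuousP := rderivable_continuous df1.
    by apply; rewrite /= in_itv.
  have -> : f1 r / r = slope r by rewrite /slope (negbTE r0).
  apply: cvg_trans; apply: near_eq_cvg.
  change (\forall s \near r, `[0, 1]%classic s -> f1 s / s = slope s).
  by apply: filterS (near_neq0 r0) => s s0 _; rewrite /slope (negbTE s0).
have r001 : 0 <= (0 : R) <= 1 by lra.
apply/cvgrPdist_lt => e e0; rewrite r0.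
move/cvgrPdist_lt : (df1 r001) => /(_ _ e0) H.
change (\forall s \near (0 : R), `[0, 1]%classic s -> `|slope 0 - slope s| < e).
have {}H : \forall s \near (0 : R), s != 0 -> `[0, 1]%classic s ->
  `|f2 0 - diff_quot f1 0 s| < e by exact: H.
apply: filterS H => s H s01; rewrite /slope eqxx.
have [s0|s0] := eqVneq s 0; first by rewrite subrr normr0.
by have := H s0 s01; rewrite /diff_quot f10 !subr0.
Qed.

(* Boundary terms of the successive integrations by parts: of the determinant,
   then of the bilaplacian (three times), and of the weight. *)
Let flux (l r : R) : R :=
  phi r * f1 r ^+ 2 / 2 - phi r * (r * f3 r + f2 r - slope r)
  + (12 * r ^+ 2 - 18 * r) * (r * f2 r + f1 r) - 36 * (r - 1) * (r * f1 r)
  - l * (weight r * f r).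

Let source (l r : R) : R :=
  r * phi r * (q r - l * f r) + (12 * r ^+ 2 - 18 * r) * f1 r ^+ 2 / 2
  - 36 * r * f1 r - l * weight r * f1 r.

Let is_derive_flux (l r : R) : 0 < r < 1 ->
  is_derive r 1 (flux l) (source l r).
Proof.
move=> r01; have r0 : r != 0 by rewrite gt_eqF//; lra.
have dI (g : R -> R) : (forall r, 0 <= r <= 1 -> rderivable g r) ->
    is_derive r 1 g (rderiv g r).
  by move=> dg; apply: rderivable_is_derive => //; apply: dg; lra.
have := dI _ df; have := dI _ df1; have := dI _ df2; have := dI _ df3.
rewrite -/f1 -/f2 -/f3 -/f4 => D4 D3 D2 D1.
have := is_derive_flux_formula l r0 D1 D2 D3 D4.
have <- : q r = f1 r * f2 r / r -
    (f4 r + 2 * f3 r / r - f2 r / r ^+ 2 + f1 r / r ^+ 3).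
  have Hf : rhess_det f r = f1 r * f2 r / r.
    by rewrite /rhess_det /ext0 (negbTE r0).
  have Bf := bilaplacianE df1 df2 df3 r01.
  by rewrite (qE r01) Hf Bf.
apply: near_eq_is_derive.
by apply: filterS (near_neq0 r0) => s s0; rewrite /flux /slope (negbTE s0).
Qed.

(** The flux vanishes at [0] because [f1 0 = 0] makes [slope] cancel [f2], and
    at [1] by the Navier conditions and the choice of [phi]; so the source
    has integral [0], and [coercivity] bounds what it adds to the integrand.
    Keeping the multiplier [l] free avoids the Cauchy-Schwarz
    inequality: squares are completed pointwise. *)
Lemma moment_dissipation (l : R) :
  - (l ^+ 2 / 2 + 338) <=
  \int[lebesgue_measure]_(r in `[0, 1]) (r * phi r * (q r - l * f r)).
Proof.
have cf : cont01 f := rderivable_continuous df.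
have cf1 : cont01 f1 := rderivable_continuous df1.
have cf2 : cont01 f2 := rderivable_continuous df2.
have cf3 : cont01 f3 := rderivable_continuous df3.
have cp := @phi_cont01 R; have cw := @weight_cont01 R.
have cs : cont01 (source l) by rewrite /source; prove_cont01.
have cF : cont01 (flux l) by rewrite /flux; prove_cont01.
have I0 : \int[lebesgue_measure]_(r in `[0, 1]) source l r = 0.
  rewrite (Rintegral_FTC01 cs cF (@is_derive_flux l)).
  have lap1 : f2 1 + f1 1 = 0.
    by rewrite -lapb (rlapE df1) ?divr1//; lra.
  rewrite /flux /slope eqxx f10 fb /phi /weight; lra.
pose c := - (l ^+ 2 / 2 + 338).
have Ic : \int[lebesgue_measure]_(r in `[0, 1]) (source l r + c) = c.
  rewrite RintegralD//.
  - rewrite I0 add0r Rintegral_cst//= lebesgue_measure_itv/= lte_fin ltr01.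
    by rewrite oppr0 adde0 /= mulr1.
  - exact: Rintegrable01.
  - by apply: Rintegrable01; prove_cont01.
rewrite -/c -Ic; apply: le_Rintegral => //.
- by apply: Rintegrable01; prove_cont01.
- by apply: Rintegrable01; prove_cont01.
move=> r /=; rewrite in_itv/= => r01; rewrite /source /c.
have := coercivity (f1 r) l r01; lra.
Qed.

End Dissipation.

(** * A Riccati differential inequality *)

(** The family of affine bounds is the inequality [y' >= (y^2 - K^2) / 2] in
    linearized form.  Taking [l = K] gives [y' >= K * (y - K)], so
    [expR (- K t) * (y - K)] increases and [y] stays above [K]; this replaces a
    continuation argument.  Taking then [l = y t] gives
    [(y - K)' >= (y - K) ^+ 2 / 2], so [- (y - K)^-1 - t / 2] increases. *)
Lemma riccati_time_bound (R : realType) (K tau : R) (y y' : R -> R) :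
  0 <= K -> 0 < tau -> {within `[0, tau], continuous y} ->
  (forall t : R, 0 < t < tau -> is_derive t 1 y (y' t)) ->
  (forall t l : R, 0 < t < tau -> l * y t - (l ^+ 2 + K ^+ 2) / 2 <= y' t) ->
  K < y 0 -> tau <= 2 / (y 0 - K).
Proof.
move=> K0 tau0 cy dy yy' Ky0.
have z0 : 0 < y 0 - K by rewrite subr_gt0.
have nbound (h dh : R -> R) : {within `[0, tau], continuous h} ->
    (forall t : R, 0 < t < tau -> is_derive t 1 h (dh t)) ->
    (forall t : R, 0 < t < tau -> 0 <= dh t) ->
    forall t, 0 <= t <= tau -> h 0 <= h t.
  move=> ch Dh dh0 t /andP[t0 tt].
  apply: (@ger0_derive1_ndecr _ h 0 tau) => // s; rewrite in_itv/= => sI.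
    by have ? := Dh s sI; exact: ex_derive.
  by rewrite derive1E (@derive_val _ _ _ _ _ _ _ (Dh s sI)) dh0.
have above t : 0 <= t <= tau -> K < y t.
  move=> tI; pose E s := expR (- K * s).
  have dE (s : R) : is_derive s 1 E (- K * E s).
    rewrite /E; have De := is_derive1_comp (f := expR) (g := fun s => - K * s)
      (x := s) (a := expR (- K * s)) (b := - K) _ _.
    by apply: is_derive_eq; rewrite /GRing.scale/=; ring.
  have cE : {within `[0, tau], continuous E}.
    apply: continuous_subspaceT => s; apply/differentiable_continuous.
    by apply/derivable1_diffP; have ? := dE s; exact: ex_derive.
  have := nbound (fun s => E s * (y s - K))
    (fun s => E s * (y' s - K * (y s - K))) _ _ _ t tI.
  rewrite /E mulr0 expR0 mul1r => H.
  suff : 0 < expR (- K * t) * (y t - K).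
    by rewrite pmulr_rgt0 ?expR_gt0// subr_gt0.
  apply: lt_le_trans z0 (H _ _ _).
  - move=> s; apply: cvgM; first exact: cE.
    by apply: cvgB; [exact: cy|exact: cvg_cst].
  - move=> s sI; have Dy := dy s sI; have DE := dE s.
    by rewrite -/E; apply: is_derive_eq; rewrite /GRing.scale/= /E; ring.
  - move=> s sI; apply: mulr_ge0; first exact: expR_ge0.
    by have := yy' s K sI; nra.
have zt t : 0 <= t <= tau -> y t - K != 0.
  by move=> /above Ky; rewrite subr_eq0 gt_eqF.
have tauI : 0 <= tau <= tau by rewrite lexx ltW.
have := nbound (fun s => - (y s - K)^-1 - s / 2)
  (fun s => y' s / (y s - K) ^+ 2 - 1 / 2) _ _ _ tau tauI.
have ztau : 0 < (y tau - K)^-1 by rewrite invr_gt0 subr_gt0 above.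
move=> H; suff : - (y 0 - K)^-1 - 0 / 2 <= - (y tau - K)^-1 - tau / 2 by lra.
apply: H.
- apply/subspace_continuousP => s; rewrite /= in_itv/= => sI.
  apply: cvgB; last by apply: cvgM; [exact: cvg_within|exact: cvg_cst].
  apply: cvgN; apply: cvgV; first exact: zt.
  apply: cvgB; last exact: cvg_cst.
  by move/subspace_continuousP : cy; apply; rewrite /= in_itv.
- move=> s sI; have Dy := dy s sI.
  have z : y s - K != 0 by apply: zt; lra.
  have Dz : is_derive s 1 (fun s => y s - K) (y' s).
    by apply: is_derive_eq; rewrite subr0.
  have DV := is_deriveV (f := fun s => y s - K) z Dz.
  by apply: is_derive_eq; rewrite /GRing.scale/=; field.
- move=> s sI; have Ky : K < y s by apply: above; lra.
  have := yy' s (y s) sI => Hy.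
  have z2 : 0 < (y s - K) ^+ 2 by rewrite exprn_gt0// subr_gt0.
  rewrite subr_ge0 ler_pdivlMr//; nra.
Qed.

(** * Evolution of the weighted moment *)

Lemma bounded_on_compact (R : realType) (X : topologicalType) (A : set X)
    (F : X -> R) : compact A -> {within A, continuous F} ->
  exists2 M : R, 0 <= M & forall p, A p -> `|F p| <= M.
Proof.
move=> cA cF; have /compact_bounded [M [_ HM]] := continuous_compact cF cA.
exists (Num.max M 0 + 1); first by rewrite addr_ge0// le_max lexx orbT.
move=> p Ap; apply: HM; last by exists p.
by rewrite (@le_lt_trans _ _ (Num.max M 0)) ?le_max ?lexx// ltrDl.
Qed.

Lemma ereal_lt_room (R : realType) (T : \bar R) (t : R) :
  (t%:E < T)%E -> exists2 v : R, t < v & (v%:E < T)%E.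
Proof.
case: T => [T| |//].
  by rewrite lte_fin => tT; exists ((t + T) / 2); rewrite ?lte_fin; lra.
by move=> _; exists (t + 1); [lra|exact: ltry].
Qed.

Lemma normr_r_phi (R : realType) (r : R) : 0 <= r <= 1 -> `|r * phi r| <= 18.
Proof.
move=> /andP[r0 r1].
have r2 : 0 <= r ^+ 2 <= 1 by rewrite sqr_ge0 expr_le1.
have r3 : 0 <= r ^+ 3 <= 1 by rewrite exprn_ge0// expr_le1.
rewrite normrM ger0_norm//.
have : `|phi r| <= 18 by rewrite ler_norml /phi; lra.
have := normr_ge0 (phi r); nra.
Qed.

Section MomentFlow.
Context (R : realType) (u0 : R -> R) (T : \bar R) (u : R -> R -> R).
Hypothesis su : smooth_solution u0 T u.

Let pu := solution_profile su.
Let pt := profile_dt pu.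

Definition moment (t : R) : R :=
  \int[lebesgue_measure]_(r in `[0, 1]) (r * phi r * u r t).

Let cphi := @phi_cont01 R.

Lemma profile_cont01 (U : R -> R -> R) (t : R) : smooth_profile T U ->
  0 < t -> (t%:E < T)%E -> cont01 (U ^~ t).
Proof.
by move=> pU t0 tT; apply: rderivable_continuous => r r01;
  exact: (profile_rderivable pU).
Qed.

Let Rintegrable_moment (g : R -> R) : cont01 g ->
  lebesgue_measure.-integrable `[0, 1] (EFin \o (fun r => r * phi r * g r)).
Proof. by move=> cg; apply: Rintegrable01; have cp := cphi; prove_cont01. Qed.

(** [u_t] is continuous on compact subsets of the closed radius times the open
    time interval, which gives the domination required for differentiating
    under the integral sign. *)
Lemma moment_is_derive (t : R) : 0 < t -> (t%:E < T)%E ->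
  is_derive t 1 moment
    (\int[lebesgue_measure]_(r in `[0, 1]) (r * phi r * derive1 (u r) t)).
Proof.
move=> t0 tT; have [v tv vT] := ereal_lt_room tT.
have [M M0 HM] : exists2 M : R, 0 <= M & forall p : R * R,
    (`[0, 1] `*` `[t / 2, v]) p -> `|derive1 (u p.1) p.2| <= M.
  apply: (@bounded_on_compact _ _ _ (fun p : R * R => derive1 (u p.1) p.2)).
    by apply: compact_setX; exact: segment_compact.
  apply: continuous_subspaceW (profile_continuous pt) => -[r s] /=.
  rewrite !in_itv/= => -[r01 /andP[ts sv]]; split => //; first lra.
  by apply: le_lt_trans vT; rewrite lee_fin.
have I s : `]t / 2, v[%classic s -> 0 < s /\ (s%:E < T)%E.
  rewrite /= in_itv/= => /andP[ts sv]; split; first lra.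
  by apply: lt_trans vT; rewrite lte_fin.
have It : `]t / 2, v[%classic t by rewrite /= in_itv/=; lra.
pose f (s r : R) := r * phi r * u r s.
have Df s r : `]t / 2, v[%classic s -> `[0, 1]%classic r ->
    is_derive s 1 (f ^~ r) (r * phi r * derive1 (u r) s).
  move=> /I[s0 sT]; rewrite /= in_itv/= => r01.
  have Du := profile_is_derive pu r01 s0 sT.
  by rewrite /f; apply: is_derive_eq; rewrite /GRing.scale/=; ring.
have := @cvg_differentiation_under_integral R _ _ lebesgue_measure f
  `[0, 1]%classic (measurable_itv _) t (t / 2) v It _ _ (fun=> 18 * M) _ _ _.
have -> : \int[lebesgue_measure]_(r in `[0, 1]) partial1of2 f t r =
    \int[lebesgue_measure]_(r in `[0, 1]) (r * phi r * derive1 (u r) t).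
  apply: eq_Rintegral => r; rewrite inE => r01.
  by rewrite partial1of2E (@derive_val _ _ _ _ _ _ _ (Df t r It r01)).
move=> H; have {}H :
    h^-1 *: ((moment \o shift t) (h *: 1) - moment t) @[h --> 0^'] -->
    \int[lebesgue_measure]_(r in `[0, 1]) (r * phi r * derive1 (u r) t).
  under eq_fun do rewrite /= [_ *: 1]mulr1.
  apply: H.
  - move=> s /I[s0 sT]; apply: Rintegrable_moment; exact: profile_cont01.
  - by move=> s r Is r01; have ? := Df s r Is r01; exact: ex_derive.
  - by move=> _; rewrite mulr_ge0.
  - by apply: Rintegrable01; exact: cont01_cst.
  - move=> s r Is r01; rewrite partial1of2E.
    rewrite (@derive_val _ _ _ _ _ _ _ (Df s r Is r01)) normrM ler_pM//.
      by apply: normr_r_phi; rewrite /= in_itv in r01.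
    apply: (HM (r, s)); split => //=.
    by move: Is; rewrite /= !in_itv/=; lra.
split; first by apply/cvg_ex; eexists; exact: H.
exact: cvg_lim H.
Qed.

(** [moment_dissipation] with [u_t] in the role of [q], in the affine form on
    which [riccati_time_bound] operates. *)
Lemma moment_growth (t l : R) : 0 < t -> (t%:E < T)%E ->
  l * moment t - (l ^+ 2 + 26 ^+ 2) / 2 <=
  \int[lebesgue_measure]_(r in `[0, 1]) (r * phi r * derive1 (u r) t).
Proof.
move=> t0 tT; pose q r := derive1 (u r) t.
have p1 := profile_dr pu; have p2 := profile_dr p1; have p3 := profile_dr p2.
have cu : cont01 (u ^~ t) := profile_cont01 pu t0 tT.
have cq : cont01 q := profile_cont01 pt t0 tT.
have := @moment_dissipation R (u ^~ t) q
  (fun r r01 => profile_rderivable pu r01 t0 tT)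
  (fun r r01 => profile_rderivable p1 r01 t0 tT)
  (fun r r01 => profile_rderivable p2 r01 t0 tT)
  (fun r r01 => profile_rderivable p3 r01 t0 tT)
  (solution_rderiv0 su t0 tT) (sol_bc0 su t0 tT) (sol_bc2 su t0 tT) cq _ l.
have -> : \int[lebesgue_measure]_(r in `[0, 1])
      (r * phi r * (q r - l * u r t)) =
    \int[lebesgue_measure]_(r in `[0, 1]) (r * phi r * q r) - l * moment t.
  rewrite /moment -RintegralZl//; last exact: Rintegrable_moment.
  rewrite -RintegralB//.
  - by apply: eq_Rintegral => r _; ring.
  - exact: Rintegrable_moment.
  - by apply: Rintegrable01; have cp := cphi; prove_cont01.
rewrite -/q; set I := \int[lebesgue_measure]_(r in _) _ => H.
suff : - (l ^+ 2 / 2 + 338) <= I - l * moment t by lra.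
by apply: H => r /andP[r0 r1]; apply: (sol_eq su) => //; rewrite ltW.
Qed.

End MomentFlow.

(** * The initial time *)

Lemma cvg_eq_near (R : realType) (F : set_system R) (f : R -> R) (l c : R) :
  ProperFilter F -> f @ F --> l -> (\forall x \near F, f x = c) -> l = c.
Proof.
move=> FF fl fc; have fc' : f @ F --> c.
  apply: (@cvg_trans _ ((fun=> c) @ F)); last exact: cvg_cst.
  by apply: near_eq_cvg; apply: filterS fc => x ->.
exact: (cvg_unique _ fl fc').
Qed.

Section InitialTrace.
Context (R : realType) (u0 : R -> R) (T : \bar R) (u : R -> R -> R).
Hypothesis su : smooth_solution u0 T u.

Let cont_rad (v : R) : (v%:E < T)%E ->
  {within `[0, 1] `*` `[0, v], continuous (fun p : R * R => u p.1 p.2)}.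
Proof.
move=> vT; apply: continuous_subspaceW (sol_cont su) => -[r s] /=.
rewrite !in_itv/= => -[r01 /andP[s0 sv]]; split => //.
by apply: le_lt_trans vT; rewrite lee_fin.
Qed.

Let cont_r (t : R) : 0 <= t -> (t%:E < T)%E -> cont01 (u ^~ t).
Proof.
move=> t0 tT; apply/subspace_continuousP => r; rewrite /= => r01.
have /subspace_continuousP/(_ (r, t)) := cont_rad tT.
move=> H P Pr; have tI : (`[0, 1] `*` `[0, t])%classic (r, t).
  by split => //=; rewrite in_itv/= t0 lexx.
have {H} HP : \forall p \near (r, t), (`[0, 1] `*` `[0, t])%classic p ->
  P (u p.1 p.2) := H tI P Pr.
change (\forall s \near r, `[0, 1]%classic s -> P (u s t)).
have lc : (s, t) @[s --> r] --> (r, t) by exact: (cvg_pair cvg_id (cvg_cst _)).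
have {}HP : \forall s \near r, (`[0, 1] `*` `[0, t])%classic (s, t) ->
  P (u s t) := lc _ HP.
apply: filterS HP => s H' s01; apply: H'; split => //=.
by rewrite in_itv/= t0 lexx.
Qed.

Let cont_abs (r t : R) : 0 <= r <= 1 -> (`|t|%:E < T)%E ->
  {for t, continuous (fun s => u r `|s|)}.
Proof.
move=> r01 tT; have [v tv vT] := ereal_lt_room tT.
have /subspace_continuousP/(_ (r, `|t|)) := cont_rad vT.
move=> H P Pr; have tI : (`[0, 1] `*` `[0, v])%classic (r, `|t|).
  by split => //=; rewrite in_itv//= normr_ge0 ltW.
have {H} HP : \forall p \near (r, `|t|), (`[0, 1] `*` `[0, v])%classic p ->
  P (u p.1 p.2) := H tI P Pr.
change (\forall s \near t, P (u r `|s|)).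
have cn : `|s| @[s --> t] --> `|t| by apply: cvg_norm; exact: cvg_id.
have lc : (r, `|s|) @[s --> t] --> (r, `|t|).
  exact: (cvg_pair (cvg_cst _) cn).
have {}HP : \forall s \near t, (`[0, 1] `*` `[0, v])%classic (r, `|s|) ->
  P (u r `|s|) := lc _ HP.
have sv : \forall s \near t, `|s| < v := cn _ (lt_nbhsl tv).
apply: filterS2 HP sv => s H' sv; apply: H'; split => //=; rewrite in_itv//=.
by rewrite normr_ge0 ltW.
Qed.

(** The boundary condition holds for positive times only; it passes to the
    limit because [u] is continuous up to [t = 0]. *)
Lemma solution_vanishes_corner : u 1 0 = 0.
Proof.
have T0 := sol_time su.
have T0' : (`|0 : R|%:E < T)%E by rewrite normr0.
have I1 : 0 <= (1 : R) <= 1 by lra.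
have c0 := cont_abs I1 T0'.
have c1 : u 1 `|s| @[s --> (0 : R)^'] --> u 1 `|0 : R|.
  move=> P P1; have H : \forall s \near (0 : R), P (u 1 `|s|) := c0 P P1.
  change (\forall s \near (0 : R), s != 0 -> P (u 1 `|s|)).
  by apply: filterS H.
rewrite normr0 in c1; apply: (cvg_eq_near _ c1).
have sT : \forall s \near (0 : R), (`|s|%:E < T)%E.
  have cn : `|s| @[s --> (0 : R)] --> `|0 : R|.
    by apply: cvg_norm; exact: cvg_id.
  by apply: (cn _ (near_lt_ereal _)); rewrite normr0.
change (\forall s \near (0 : R), s != 0 -> u 1 `|s| = 0).
by apply: filterS sT => s sT s0; apply: (sol_bc0 su) => //; rewrite normr_gt0.
Qed.

(** The initial condition is given for [r < 1]; both sides are continuous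
    at [1]. *)
Lemma initial_trace : cont01 u0 -> forall r, 0 <= r <= 1 -> u0 r = u r 0.
Proof.
move=> cu0 r /andP[r0]; rewrite le_eqVlt => /orP[/eqP->|r1]; last first.
  by rewrite (sol_init su)// r0.
have cu : cont01 (u ^~ 0) := cont_r (lexx 0) (sol_time su).
have cd : cont01 (fun r => u0 r - u r 0) by prove_cont01.
have [_ _ d1] := (continuous_within_itvP _ (@ltr01 R)).1 cd.
suff : u0 1 - u 1 0 = 0 by move/eqP; rewrite subr_eq0 => /eqP.
apply: (cvg_eq_near _ d1); near=> s.
rewrite (sol_init su) ?subrr//; apply/andP; split => //.
by near: s; apply: nbhs_left_ge; exact: ltr01.
Unshelve. all: by end_near. Qed.

Lemma moment_initial : C1_01 u0 ->
  moment u 0 = - \int[lebesgue_measure]_(r in `[0, 1]) (weight r * rderiv u0 r).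
Proof.
move=> [du0 cdu0].
have d0 r : 0 <= r <= 1 -> rderivable u0 r.
  by move=> r01; apply: du0; rewrite in_itv.
have cu0 : cont01 u0 := rderivable_continuous d0.
have cdu : cont01 (rderiv u0) := cdu0.
have cp := @phi_cont01 R; have cw := @weight_cont01 R.
have u01 : u0 1 = 0 by rewrite initial_trace ?solution_vanishes_corner//; lra.
have -> : moment u 0 = \int[lebesgue_measure]_(r in `[0, 1]) (r * phi r * u0 r).
  apply: eq_Rintegral => r; rewrite inE/= in_itv/= => r01.
  by rewrite initial_trace.
have Dwu (r : R) : 0 < r < 1 -> is_derive r 1 (fun r => weight r * u0 r)
    (r * phi r * u0 r + weight r * rderiv u0 r).
  move=> r01; have Du : is_derive r 1 u0 (rderiv u0 r).
    by apply: rderivable_is_derive => //; apply: d0; lra.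
  have Dw := is_derive_weight r.
  by apply: is_derive_eq; rewrite /GRing.scale/=; ring.
have cwu : cont01 (fun r => weight r * u0 r) by prove_cont01.
have cD : cont01 (fun r => r * phi r * u0 r + weight r * rderiv u0 r).
  by prove_cont01.
have := Rintegral_FTC01 cD cwu Dwu.
rewrite RintegralD//; last 2 first.
- by apply: Rintegrable01; prove_cont01.
- by apply: Rintegrable01; prove_cont01.
rewrite u01 mulr0 /weight !expr0n/= !mulr0 => H.
by move: H; lra.
Qed.

(** Continuity at [0] is one-sided; replacing [t] by [`|t|] turns it into
    continuity at an interior point of an open interval, where the theorem on
    integrals with a parameter applies. *)
Lemma moment_continuous (tau : R) : 0 < tau -> (tau%:E < T)%E ->
  {within `[0, tau], continuous (moment u)}.
Proof.
move=> tau0 tauT; have [v tv vT] := ereal_lt_room tauT.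
have [M M0 HM] : exists2 M : R, 0 <= M & forall p : R * R,
    (`[0, 1] `*` `[0, v]) p -> `|u p.1 p.2| <= M.
  apply: (@bounded_on_compact _ _ _ (fun p : R * R => u p.1 p.2)).
    by apply: compact_setX; exact: segment_compact.
  exact: cont_rad.
have I s : `](- v), v[%classic s -> 0 <= `|s| <= v /\ (`|s|%:E < T)%E.
  rewrite /= in_itv/= -ltr_norml => sv; rewrite normr_ge0 ltW//; split => //.
  by apply: lt_trans vT; rewrite lte_fin.
have cp := @phi_cont01 R.
have cY : {in `](- v), v[%classic, continuous (fun s =>
    \int[lebesgue_measure]_(r in `[0, 1]) (r * phi r * u r `|s|))}.
  apply: (@continuity_under_integral R _ _ lebesgue_measure
    (fun s r => r * phi r * u r `|s|) `[0, 1]%classic (measurable_itv _) _ _ _ _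
    (fun=> 18 * M)).
  - move=> s /I[/andP[s0 _] sT]; apply: Rintegrable01.
    by have cu := cont_r s0 sT; prove_cont01.
  - apply: aeW => r; rewrite /= in_itv/= => r01 s; rewrite inE => /I[_ sT].
    by apply: cvgM; [exact: cvg_cst|exact: cont_abs].
  - by apply: Rintegrable01; exact: cont01_cst.
  - move=> s /I[sv sT]; apply: aeW => r; rewrite /= in_itv/= => r01.
    rewrite normrM ler_pM//; first exact: normr_r_phi.
    by apply: (HM (r, `|s|)); split => /=; rewrite in_itv.
apply/subspace_continuousP => t; rewrite /= in_itv/= => /andP[t0 tt].
have tI : t \in `](- v), v[%classic by rewrite inE/= in_itv/=; lra.
have := cY t tI => /cvg_within_filter H.
pose Y (s : R) := \int[lebesgue_measure]_(r in `[0, 1]) (r * phi r * u r `|s|).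
have YE (s : R) : 0 <= s -> Y s = moment u s by move=> s0; rewrite /Y ger0_norm.
have {}H := H `[0, tau]%classic; rewrite /= -/(Y t) YE// in H.
apply: cvg_trans H; apply: near_eq_cvg.
change (\forall s \near t, `[0, tau]%classic s -> Y s = moment u s).
apply: (@nearW _ (nbhs t)) => s; rewrite /= in_itv/= => /andP[s0 _].
exact: YE.
Qed.

End InitialTrace.

Lemma existence_time_bound (R : realType) (u0 : R -> R) (T : \bar R)
    (u : R -> R -> R) (m : R) :
  C1_01 u0 -> smooth_solution u0 T u ->
  m = (- \int[lebesgue_measure]_(r in `[0, 1]) (weight r * rderiv u0 r)) ->
  26 < m -> (T <= (2 / (m - 26))%:E)%E.
Proof.
move=> cu0 su mE m26; rewrite leNgt; apply/negP => bT.
have [tau btau tauT] := ereal_lt_room bT.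
have tau0 : 0 < tau by apply: lt_trans btau; rewrite divr_gt0// subr_gt0.
have m0 : moment u 0 = m by rewrite (moment_initial su).
have TT t : 0 < t < tau -> (t%:E < T)%E.
  by move=> /andP[_ tt]; apply: lt_trans tauT; rewrite lte_fin.
suff : tau <= 2 / (m - 26) by rewrite leNgt btau.
have cm := moment_continuous su tau0 tauT.
rewrite -m0; apply: (riccati_time_bound _ tau0 cm).
- by [].
- by move=> t tI; apply: (moment_is_derive su) (TT t tI); case/andP: tI.
- by move=> t l tI; apply: (moment_growth su) (TT t tI); case/andP: tI.
- by rewrite m0.
Qed.

Unset Implicit Arguments.

Theorem theorem5p2 (R : realType) :
  exists K : R, 0 < K /\
    forall (u0 : R -> R) (T : \bar R) (u : R -> R -> R),
      C1_01 u0 ->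
      smooth_solution u0 T u ->
      \int[lebesgue_measure]_(r in `[0, 1])
        ((4 / 5 * r ^+ 5 - 9 / 4 * r ^+ 4 + 5 / 2 * r ^+ 2) * rderiv u0 r)
        < - K ->
      exists Tstar : R, lifespan u0 T u = Tstar%:E.
Proof.
exists 26; split => // u0 T u cu0 su I26.
pose m := - \int[lebesgue_measure]_(r in `[0, 1]) (weight r * rderiv u0 r).
have m26 : 26 < m by rewrite ltrNr.
have ub : (lifespan u0 T u <= (2 / (m - 26))%:E)%E.
  apply: ge_ereal_sup => T' [v [_ sv _]].
  exact: existence_time_bound cu0 sv _ m26.
have lb : (0 < lifespan u0 T u)%E.
  apply: lt_le_trans (sol_time su) _; apply: ereal_sup_ubound.
  by exists u; split.
exists (fine (lifespan u0 T u)); rewrite fineK//.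
rewrite fin_numE gt_eqF ?lt_eqF//.
- exact: le_lt_trans ub (ltry _).
- exact: lt_trans (ltNyr 0) lb.
Qed.
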